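(* Let $B\in\mathbb{C}^{n\times n}$ be diagonalizable, $B=Z\Lambda Z^{-1}$ with $\Lambda=\mathrm{diag}(\lambda_1,\dots,\lambda_n)$, and let $Y\in\mathbb{C}^{n\times u}$. Let $X_k$ be the approximate solution of the linear system with multiple right-hand sides $BX=Y$ obtained with $k$ iterations of block-GMRES starting with $X_0=0$. Let $W=Z^{-1}Y$, with $(j,\ell)$ entry $w_{j\ell}$. Then $$\|Y-BX_k\|_2\le \|Z\|_2 \min_{\substack{q\in\Pi_k\\ q(0)=1}} \left(\sum_{\ell=1}^u\sum_{j = 1}^n |w_{j\ell}\, q(\lambda_j)|^2 \right)^{1/2}.$$
   Context: $\Pi_k$ is the space of complex polynomials of degree at most $k$. $\|\cdot\|_2$ is the spectral norm of a matrix and $\|\cdot\|_F$ the Frobenius norm. Block-GMRES for $BX=Y$ with initial guess $X_0=0$: the $k$-th approximate solution $X_k$ lies in the block Krylov space $\{\sum_{i=0}^{k-1}B^iYC_i : C_0,\dots,C_{k-1}\in\mathbb{C}^{u\times u}\}$ and minimizes the residual norm $\|Y-BX\|_F$ over all $X$ in that space. *)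

(* Defs.v *)
(* The complex numbers are R[i] for R : realType. *)
From mathcomp Require Import all_boot all_order all_algebra.
From mathcomp Require Import boolp classical_sets reals complex.

Set Implicit Arguments.
Unset Strict Implicit.
Unset Printing Implicit Defensive.

Import Order.TTheory GRing.Theory Num.Theory.
Local Open Scope classical_set_scope.
Local Open Scope ring_scope.

(* The library's norm `|z| on R[i] takes its values in R[i]; normc is the same
   modulus as an element of R. *)
Definition cabs (R : realType) (z : R[i]) : R := ComplexField.Normc.normc z.

Definition vec_norm2 (R : realType) (n : nat) (x : 'cV[R[i]]_n) : R :=
  Num.sqrt (\sum_(i < n) cabs (x i 0) ^+ 2).

Definition frobenius_norm (R : realType) (m n : nat) (A : 'M[R[i]]_(m, n)) : R :=
  Num.sqrt (\sum_(i < m) \sum_(j < n) cabs (A i j) ^+ 2).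

(* The operator norm induced by the Euclidean norms.  Taking the closed unit
   ball rather than the unit sphere keeps the set nonempty when n = 0. *)
Definition spectral_norm (R : realType) (m n : nat) (A : 'M[R[i]]_(m, n)) : R :=
  sup [set vec_norm2 (A *m x) | x in [set x : 'cV[R[i]]_n | vec_norm2 x <= 1]].

Definition block_krylov (R : realType) (n u : nat)
    (B : 'M[R[i]]_n) (Y : 'M[R[i]]_(n, u)) (k : nat) : set 'M[R[i]]_(n, u) :=
  [set X | exists C : 'I_k -> 'M[R[i]]_u,
     X = \sum_(i < k) (B ^+ i) *m Y *m C i].

(* A relation rather than a function: for singular B the minimizer X need not
   be unique (its residual Y - B X is). *)
Definition is_block_gmres_iterate (R : realType) (n u : nat)
    (B : 'M[R[i]]_n) (Y : 'M[R[i]]_(n, u)) (k : nat) (X : 'M[R[i]]_(n, u)) :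
    Prop :=
  block_krylov B Y k X /\
  forall X', block_krylov B Y k X' ->
    frobenius_norm (Y - B *m X) <= frobenius_norm (Y - B *m X').

Definition is_minimum (R : realType) (S : set R) (m : R) : Prop :=
  S m /\ lbound S m.

(* size q is one more than the degree of q (and 0 for q = 0). *)
Definition residual_polys (R : realType) (k : nat) : set {poly R[i]} :=
  [set q : {poly R[i]} | (size q <= k.+1)%N /\ q.[0] = 1].
Arguments residual_polys R k : clear implicits.

(* Main.v *)
Require Import Defs.
From mathcomp Require Import all_boot all_order all_algebra.
From mathcomp Require Import boolp classical_sets reals complex.

(** A residual polynomial q = 1 - t p(t) yields the point X = p(B) Y of the block
    Krylov space, whose residual is q(B) Y = Z q(Lambda) W
    ([krylov_residual_of_poly]).  The iterate minimizes the Frobenius norm of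
    the residual, and the Frobenius norm dominates the spectral norm
    ([spectral_norm_le_frobenius]), so the spectral norm of Y - B Xk is at most
    the Frobenius norm of Z q(Lambda) W.  Pulling Z out at the cost of its
    spectral norm ([frobenius_norm_mulmx_le]) leaves the Frobenius norm of
    q(Lambda) W, whose (j, l) entry is w_jl q(lambda_j).

    This holds for every q, but the minimum over q must also be shown to be
    attained.  The objective depends on W only through the Euclidean norms s_j
    of its rows, and the vector (s_j q(lambda_j))_j is an affine function of the
    coefficients of p: minimizing its length is a linear least squares problem
    ([weighted_residual_poly_min]), and such a problem is solved by an orthogonal
    projection ([least_squares_exists]). *)

Set Implicit Arguments.
Unset Strict Implicit.

Import Order.TTheory GRing.Theory Num.Theory.
Local Open Scope classical_set_scope.
Local Open Scope ring_scope.

Lemma cabsM (R : realType) (x y : R[i]) : cabs (x * y) = cabs x * cabs y.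
Proof. exact: ComplexField.Normc.normcM. Qed.

Lemma cabs_real (R : realType) (a : R) : 0 <= a -> cabs (real_complex R a) = a.
Proof. by move=> a0; rewrite /cabs /= expr0n addr0 sqrtr_sqr ger0_norm. Qed.

Lemma sqr_normc_cabs (R : realType) (z : R[i]) :
  `|z| ^+ 2 = real_complex R (cabs z ^+ 2).
Proof. by rewrite rmorphXn. Qed.

Lemma sum_sqr_cabs_ge0 (R : realType) (I : finType) (f : I -> R[i]) :
  0 <= \sum_i cabs (f i) ^+ 2.
Proof. by apply: sumr_ge0 => i _; exact: sqr_ge0. Qed.

Lemma sqr_vec_norm2 (R : realType) (n : nat) (x : 'cV[R[i]]_n) :
  vec_norm2 x ^+ 2 = \sum_(i < n) cabs (x i 0) ^+ 2.
Proof. by rewrite sqr_sqrtr // sum_sqr_cabs_ge0. Qed.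

Lemma sqr_frobenius_norm (R : realType) (m n : nat) (A : 'M[R[i]]_(m, n)) :
  frobenius_norm A ^+ 2 = \sum_(i < m) \sum_(j < n) cabs (A i j) ^+ 2.
Proof.
by rewrite sqr_sqrtr //; apply: sumr_ge0 => i _; exact: sum_sqr_cabs_ge0.
Qed.

(** Bridge between the real-valued norms above and the Hermitian product of row
    vectors, which gives access to the Cauchy-Schwarz inequality and to
    orthogonal projections. *)
Lemma dotmx_self (R : realType) (n : nat) (v : 'rV[R[i]]_n) :
  dotmx v v = real_complex R (\sum_(j < n) cabs (v 0 j) ^+ 2).
Proof.
rewrite dotmxE mxE rmorph_sum; apply: eq_bigr => j _.
by rewrite !mxE -normCK; exact: sqr_normc_cabs.
Qed.

(** Cauchy-Schwarz applied to each row of A.  Besides comparing the two norms,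
    this makes the supremum defining the spectral norm finite. *)
Lemma vec_norm2_mulmx_le_frobenius (R : realType) (m n : nat)
    (A : 'M[R[i]]_(m, n)) (x : 'cV[R[i]]_n) :
  vec_norm2 (A *m x) <= frobenius_norm A * vec_norm2 x.
Proof.
rewrite -ler_sqr ?nnegrE ?mulr_ge0 ?sqrtr_ge0 //.
rewrite exprMn !sqr_vec_norm2 sqr_frobenius_norm mulr_suml.
apply: ler_sum => i _.
(* The product is conjugate-linear on the right, hence the conjugate of x. *)
pose xh : 'rV[R[i]]_n := map_mx Num.conj x^T.
have -> : (A *m x) i 0 = dotmx (row i A) xh.
  rewrite dotmxE !mxE; apply: eq_bigr => j _.
  by rewrite !mxE conjCK.
have : `|dotmx (row i A) xh| ^+ 2
    <= dotmx (row i A) (row i A) * dotmx xh xh.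
  by have [] := CauchySchwarz (@dotmx R[i] n) (row i A) xh.
rewrite !dotmx_self sqr_normc_cabs -rmorphM lecR.
congr (_ <= _ * _); apply: eq_bigr => j _; first by rewrite mxE.
by rewrite !mxE /cabs; congr (_ ^+ 2); case: (x j 0) => a b /=; rewrite sqrrN.
Qed.

Lemma frobenius_norm_ubound (R : realType) (m n : nat)
    (A : 'M[R[i]]_(m, n)) :
  ubound [set vec_norm2 (A *m x) | x in [set x : 'cV[R[i]]_n | vec_norm2 x <= 1]]
    (frobenius_norm A).
Proof.
move=> _ [x /= x1 <-].
apply: le_trans (vec_norm2_mulmx_le_frobenius A x) _.
by rewrite ler_piMr // sqrtr_ge0.
Qed.

Lemma vec_norm2Z (R : realType) (n : nat) (a : R) (x : 'cV[R[i]]_n) :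
  0 <= a -> vec_norm2 (real_complex R a *: x) = a * vec_norm2 x.
Proof.
move=> a0; apply/eqP; rewrite -(@eqrXn2 _ 2) ?mulr_ge0 ?sqrtr_ge0 //.
rewrite exprMn !sqr_vec_norm2 mulr_sumr; apply/eqP/eq_bigr => i _.
by rewrite mxE cabsM cabs_real // exprMn.
Qed.

Lemma vec_norm2_0 (R : realType) (n : nat) : vec_norm2 (0 : 'cV[R[i]]_n) = 0.
Proof. by rewrite -(scale0r 0) -(rmorph0 (real_complex R)) vec_norm2Z // mul0r. Qed.

Lemma spectral_norm_ge0 (R : realType) (m n : nat) (A : 'M[R[i]]_(m, n)) :
  0 <= spectral_norm A.
Proof.
apply: le_trans (_ : vec_norm2 (A *m 0) <= _); first exact: sqrtr_ge0.
apply: ub_le_sup.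
  by exists (frobenius_norm A); exact: frobenius_norm_ubound.
by exists 0; rewrite //= vec_norm2_0 ler01.
Qed.

Lemma spectral_norm_le_frobenius (R : realType) (m n : nat)
    (A : 'M[R[i]]_(m, n)) :
  spectral_norm A <= frobenius_norm A.
Proof.
apply: ge_sup; last exact: frobenius_norm_ubound.
by exists (vec_norm2 (A *m 0)); exists 0; rewrite //= vec_norm2_0 ler01.
Qed.

Lemma vec_norm2_mulmx_le (R : realType) (m n : nat)
    (A : 'M[R[i]]_(m, n)) (x : 'cV[R[i]]_n) :
  vec_norm2 (A *m x) <= spectral_norm A * vec_norm2 x.
Proof.
have x0 : 0 <= vec_norm2 x by exact: sqrtr_ge0.
(* The general case rescales x to the unit sphere, which needs x nonzero. *)
have [xE|xN] := eqVneq (vec_norm2 x) 0.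
  apply: le_trans (vec_norm2_mulmx_le_frobenius A x) _.
  by rewrite xE !mulr0.
have xp : 0 < vec_norm2 x by rewrite lt_def xN.
rewrite -ler_pdivrMr // mulrC -vec_norm2Z ?invr_ge0 // scalemxAr.
apply: ub_le_sup.
  by exists (frobenius_norm A); exact: frobenius_norm_ubound.
by eexists; last reflexivity; rewrite /= vec_norm2Z ?invr_ge0 // mulVf.
Qed.

(** The squared Frobenius norm is the sum of the squared lengths of the columns,
    and A acts on M column by column. *)
Lemma frobenius_norm_mulmx_le (R : realType) (m n p : nat)
    (A : 'M[R[i]]_(m, n)) (M : 'M[R[i]]_(n, p)) :
  frobenius_norm (A *m M) <= spectral_norm A * frobenius_norm M.
Proof.
have sqr_frobenius_col q (N : 'M[R[i]]_(q, p)) :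
    frobenius_norm N ^+ 2 = \sum_(l < p) vec_norm2 (col l N) ^+ 2.
  rewrite sqr_frobenius_norm exchange_big; apply: eq_bigr => l _.
  by rewrite sqr_vec_norm2; apply: eq_bigr => i _; rewrite mxE.
rewrite -ler_sqr ?nnegrE ?mulr_ge0 ?sqrtr_ge0 ?spectral_norm_ge0 //.
rewrite exprMn !sqr_frobenius_col mulr_sumr; apply: ler_sum => l _.
rewrite -exprMn ler_sqr ?nnegrE ?mulr_ge0 ?sqrtr_ge0 ?spectral_norm_ge0 //.
by rewrite !colE -mulmxA vec_norm2_mulmx_le.
Qed.

(** The minimizer is the orthogonal projection of a onto the row space of M: any
    other residual differs from a - c M by a vector of that row space, so
    Pythagoras' theorem applies. *)
Lemma least_squares_exists (R : realType) (p n : nat)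
    (M : 'M[R[i]]_(p, n)) (a : 'rV[R[i]]_n) :
  exists c : 'rV[R[i]]_p, forall c' : 'rV[R[i]]_p,
    \sum_(j < n) cabs ((a - c *m M) 0 j) ^+ 2
    <= \sum_(j < n) cabs ((a - c' *m M) 0 j) ^+ 2.
Proof.
have /submxP[c cE] := proj_ortho_sub M a.
exists c => c'; rewrite -lecR -!dotmx_self.
have -> : a - c' *m M = (c - c') *m M + (a - c *m M).
  by rewrite mulmxBl [RHS]addrC addrA subrK.
set w := (c - c') *m M; set r := a - c *m M.
have wr0 : dotmx w r = 0.
  have := proj_ortho_compl_sub M a.
  rewrite cE orthomx_sym => /orthomx1P Mr0.
  by rewrite dotmxE -mulmxA Mr0 mulmx0 mxE.
have -> : dotmx (w + r) (w + r) = dotmx w w + dotmx r r by exact: hnormDd.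
by rewrite lerDr dotmx_self lecR sum_sqr_cabs_ge0.
Qed.

Lemma expr_diagonalized (F : fieldType) (n : nat)
    (Z : 'M[F]_n) (lambda : 'rV[F]_n) (i : nat) :
  Z \in unitmx ->
  (Z *m diag_mx lambda *m invmx Z) ^+ i *m Z =
  Z *m diag_mx (\row_j lambda 0 j ^+ i).
Proof.
move=> hZ; set B := Z *m _ *m _; elim: i => [|i IH].
  rewrite expr0 mul1mx -[LHS]mulmx1; congr (_ *m _).
  by apply/matrixP => j l; rewrite !mxE.
rewrite exprS -[B * _]/(B *m _) -mulmxA IH mulmxA mulmxKV // -mulmxA.
rewrite mulmx_diag; congr (_ *m diag_mx _).
by apply/rowP => j; rewrite !mxE exprS.
Qed.

Lemma horner_residual_poly (R : realType) (k : nat) (q : {poly R[i]}) (x : R[i]) :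
  residual_polys R k q -> q.[x] = 1 + \sum_(i < k) q`_i.+1 * x ^+ i.+1.
Proof.
move=> [sq q0]; rewrite (horner_coef_wide _ sq) big_ord_recl.
by rewrite expr0 mulr1 -horner_coef0 q0.
Qed.

(** With q = 1 + sum_i q_(i+1) t^(i+1), the Krylov coefficients are the scalar
    matrices - q_(i+1), so the residual is q(B) Z W = Z q(Lambda) W. *)
Lemma krylov_residual_of_poly (R : realType) (n u k : nat)
    (Z : 'M[R[i]]_n) (lambda : 'rV[R[i]]_n) (W : 'M[R[i]]_(n, u))
    (q : {poly R[i]}) :
  Z \in unitmx -> residual_polys R k q ->
  let B := Z *m diag_mx lambda *m invmx Z in
  exists2 X, block_krylov B (Z *m W) k X
    & Z *m W - B *m X = Z *m (\matrix_(j, l) (W j l * q.[lambda 0 j])).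
Proof.
move=> hZ hq B.
exists (\sum_(i < k) B ^+ i *m (Z *m W) *m (- q`_i.+1)%:M).
  by exists (fun i => (- q`_i.+1)%:M).
have powE i : B ^+ i *m (Z *m W) = Z *m (diag_mx (\row_j lambda 0 j ^+ i) *m W).
  by rewrite !mulmxA expr_diagonalized.
rewrite mulmx_sumr -sumrN.
under eq_bigr => i _.
  rewrite mulmxA mulmxA -[B *m B ^+ i]/(B * B ^+ i) -exprS powE.
  rewrite mul_mx_scalar scaleNr opprK scalemxAr; over.
rewrite -mulmx_sumr -mulmxDr; congr (_ *m _).
apply/matrixP => j l; rewrite [LHS]mxE summxE !mxE (horner_residual_poly _ hq).
rewrite mulrDr mulr1 mulr_sumr; congr (_ + _); apply: eq_bigr => i _.
by rewrite mxE mul_diag_mx !mxE mulrA mulrC.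
Qed.

(** The constraint q(0) = 1 leaves the coefficients of t, ..., t^k free.  Hence
    the vectors (s_j q(lambda_j))_j form the affine space of all s - c M, where
    row i of M is (s_j lambda_j^(i+1))_j and c_i = - q_(i+1). *)
Lemma weighted_residual_poly_min (R : realType) (n k : nat)
    (s lambda : 'rV[R[i]]_n) :
  exists2 q, residual_polys R k q &
    forall q', residual_polys R k q' ->
      \sum_(j < n) cabs (s 0 j * q.[lambda 0 j]) ^+ 2
      <= \sum_(j < n) cabs (s 0 j * q'.[lambda 0 j]) ^+ 2.
Proof.
pose M := \matrix_(i < k, j < n) (s 0 j * lambda 0 j ^+ i.+1).
have resE (q : {poly R[i]}) (c : 'rV_k) (j : 'I_n) : residual_polys R k q ->
    (forall i : 'I_k, q`_i.+1 = - c 0 i) ->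
    s 0 j * q.[lambda 0 j] = (s - c *m M) 0 j.
  move=> hq qc; rewrite (horner_residual_poly _ hq) !mxE mulrDr mulr1.
  congr (_ + _); rewrite mulr_sumr -sumrN; apply: eq_bigr => i _.
  by rewrite mxE qc mulNr mulrN mulrCA.
have [c cmin] := least_squares_exists M s.
pose q := 1 - rVpoly c * 'X.
have hq : residual_polys R k q.
  split; last by rewrite horner_coef0 coefB coef1 coefMX subr0.
  rewrite (leq_trans (size_polyD _ _)) // size_polyN geq_max size_poly1 /=.
  have [->|c0] := eqVneq (rVpoly c) 0; first by rewrite mul0r size_poly0.
  by rewrite size_mulX // ltnS size_poly.
exists q => // q' hq'.
have qE j : s 0 j * q.[lambda 0 j] = (s - c *m M) 0 j.
  apply: resE => // i.
  by rewrite coefB coef1 coefMX coef_rVpoly_ord sub0r.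
have q'E j :
    s 0 j * q'.[lambda 0 j] = (s - (\row_i - q'`_i.+1) *m M) 0 j.
  by apply: resE => // i; rewrite mxE opprK.
under eq_bigr do rewrite qE.
under [leRHS]eq_bigr do rewrite q'E.
exact: cmin.
Qed.

Unset Implicit Arguments.
Set Strict Implicit.

Theorem theorem4 (R : realType) (n u k : nat)
    (B Z : 'M[R[i]]_n) (lambda : 'rV[R[i]]_n) (Y W Xk : 'M[R[i]]_(n, u))
    (hZ : Z \in unitmx)
    (hB : B = Z *m diag_mx lambda *m invmx Z)
    (hW : W = invmx Z *m Y)
    (hXk : is_block_gmres_iterate B Y k Xk) :
  exists2 m : R,
    is_minimum
      [set Num.sqrt (\sum_(l < u) \sum_(j < n)
                       cabs (W j l * q.[lambda 0 j]) ^+ 2)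
         | q in residual_polys R k] m
    & spectral_norm (Y - B *m Xk) <= spectral_norm Z * m.
Proof.
pose s : 'rV[R[i]]_n :=
  \row_j real_complex R (Num.sqrt (\sum_(l < u) cabs (W j l) ^+ 2)).
(* Replacing row j of W by its length s_j reduces the double sum to a weighted
   sum over the eigenvalues. *)
have objE (q : {poly R[i]}) :
    \sum_(l < u) \sum_(j < n) cabs (W j l * q.[lambda 0 j]) ^+ 2
    = \sum_(j < n) cabs (s 0 j * q.[lambda 0 j]) ^+ 2.
  rewrite exchange_big; apply: eq_bigr => j _.
  rewrite mxE cabsM cabs_real ?sqrtr_ge0 // exprMn.
  rewrite sqr_sqrtr ?sum_sqr_cabs_ge0 // mulr_suml.
  by apply: eq_bigr => l _; rewrite cabsM exprMn.
have [q hq qmin] := weighted_residual_poly_min k s lambda.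
exists (Num.sqrt (\sum_(l < u) \sum_(j < n)
                     cabs (W j l * q.[lambda 0 j]) ^+ 2)).
  split; first by exists q.
  by move=> _ [q' hq' <-]; rewrite ler_wsqrtr // !objE qmin.
have YE : Y = Z *m W by rewrite hW mulKVmx.
have [X' X'krylov X'res] := krylov_residual_of_poly lambda W hZ hq.
have [_ Xkmin] := hXk.
apply: le_trans (spectral_norm_le_frobenius _) _.
rewrite -hB -YE in X'krylov X'res.
apply: le_trans (Xkmin _ X'krylov) _; rewrite X'res.
apply: le_trans (frobenius_norm_mulmx_le _ _) _.
rewrite ler_wpM2l ?spectral_norm_ge0 // /frobenius_norm exchange_big.
by rewrite ler_wsqrtr //; under eq_bigr do under eq_bigr do rewrite mxE.
Qed.
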